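(* Let $K$ be a field with an involution $\overline{\phantom{k}}$ and let $E$ be an arbitrary directed graph. If the involution $\overline{\phantom{k}}$ on $K$ is positive definite, then the induced involution $^*$ on the Leavitt path algebra $L_K(E)$ is proper.
   Context: Graphs: a (directed) graph $E=(E^0,E^1,r,s)$ consists of a set $E^0$ of vertices and a set $E^1$ of edges (no restriction on cardinalities) with maps $r,s:E^1\to E^0$ (range and source). A vertex is a sink if it emits no edges; it is an infinite emitter if $s^{-1}(v)$ is infinite. A path of length $n\ge 1$ is a sequence of edges $\mu=e_1\dots e_n$ with $r(e_i)=s(e_{i+1})$ for $i=1,\dots,n-1$; $s(\mu)=s(e_1)$, $r(\mu)=r(e_n)$. Vertices are regarded as paths of length $0$. Leavitt path algebra: $L_K(E)$ is the (associative, not necessarily unital) $K$-algebra generated by $E^0\cup E^1\cup\{e^*\mid e\in E^1\}$ with relations: (V) $vw=\delta_{v,w}v$ for $v,w\in E^0$; (P1) $s(e)e=er(e)=e$ for $e\in E^1$; (P2) $r(e)e^*=e^*s(e)=e^*$ for $e\in E^1$; (CK1) $e^*f=\delta_{e,f}r(e)$ for $e,f\in E^1$; (CK2) $v=\sum_{e\in s^{-1}(v)}ee^*$ for every $v\in E^0$ that is neither a sink nor an infinite emitter. For a path $\mu=e_1\dots e_n$, $\mu^*=e_n^*\dots e_1^*$, and $v^*=v$ for vertices; $L_K(E)$ is spanned over $K$ by the elements $pq^*$ with $p,q$ paths. Involutions: an involution on a ring $R$ is an additive map $^*:R\to R$ with $(ab)^*=b^*a^*$ and $(a^* )^*=a$.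 For a positive integer $n$, it is $n$-proper if $x_1^*x_1+\dots+x_n^*x_n=0$ implies $x_1=\dots=x_n=0$ for all $x_1,\dots,x_n\in R$; proper means $1$-proper; positive definite means $n$-proper for every positive integer $n$. Given an involution $\overline{\phantom{k}}$ on $K$, the induced involution on $L_K(E)$ is $\left(\sum_i k_ip_iq_i^*\right)^*=\sum_i\overline{k_i}\,q_ip_i^*$ for $k_i\in K$ and paths $p_i,q_i$. *)

(* Defs.v *)
From HB Require Import structures.
From mathcomp Require Import all_boot all_algebra.
From mathcomp Require Import boolp.
From Stdlib Require List.

Set Implicit Arguments.
Unset Strict Implicit.
Unset Printing Implicit Defensive.

Import GRing.Theory.
Local Open Scope ring_scope.
Local Open Scope quotient_scope.

(* Involutions on rings that need not have a unit: MathComp has no such ring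
   structure, so the multiplication is an explicit parameter. *)

Record involution (R : zmodType) (mul : R -> R -> R) := Involution {
  inv_fun :> R -> R;
  inv_add : {morph inv_fun : x y / x + y};
  inv_mul : forall x y, inv_fun (mul x y) = mul (inv_fun y) (inv_fun x);
  inv_inv : involutive inv_fun }.

Definition n_proper (R : zmodType) (mul : R -> R -> R) (n : nat)
    (star : involution mul) : Prop :=
  forall x : 'I_n -> R,
    \sum_(i < n) mul (star (x i)) (x i) = 0 -> forall i, x i = 0.

Definition proper_involution (R : zmodType) (mul : R -> R -> R)
    (star : involution mul) : Prop := n_proper 1 star.

Definition positive_definite_involution (R : zmodType) (mul : R -> R -> R)
    (star : involution mul) : Prop :=
  forall n : nat, (0 < n)%N -> n_proper n star.

Record digraph := Digraph {
  vertex : Type;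
  edge : Type;
  src : edge -> vertex;
  rng : edge -> vertex }.

(* The Leavitt path algebra is the set of formal K-algebra expressions in the
   generators, modulo the least congruence that contains the axioms of
   (non-unital, associative) K-algebras and the defining relations. *)

Section Presentation.
Variables (K : fieldType) (E : digraph).

Inductive lpa_term :=
| TVertex of vertex E
| TEdge of edge E
| TGhost of edge E
| TZero
| TOpp of lpa_term
| TAdd of lpa_term & lpa_term
| TMul of lpa_term & lpa_term
| TScale of K & lpa_term.

Definition term_sum (ts : seq lpa_term) : lpa_term := foldr TAdd TZero ts.

Inductive lpa_eq : lpa_term -> lpa_term -> Prop :=
| lpa_refl x : lpa_eq x x
| lpa_sym x y : lpa_eq x y -> lpa_eq y x
| lpa_trans x y z : lpa_eq x y -> lpa_eq y z -> lpa_eq x z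
| lpa_congrN x x' : lpa_eq x x' -> lpa_eq (TOpp x) (TOpp x')
| lpa_congrD x x' y y' :
    lpa_eq x x' -> lpa_eq y y' -> lpa_eq (TAdd x y) (TAdd x' y')
| lpa_congrM x x' y y' :
    lpa_eq x x' -> lpa_eq y y' -> lpa_eq (TMul x y) (TMul x' y')
| lpa_congrZ k x x' : lpa_eq x x' -> lpa_eq (TScale k x) (TScale k x')
| lpa_addA x y z : lpa_eq (TAdd x (TAdd y z)) (TAdd (TAdd x y) z)
| lpa_addC x y : lpa_eq (TAdd x y) (TAdd y x)
| lpa_add0 x : lpa_eq (TAdd TZero x) x
| lpa_addN x : lpa_eq (TAdd (TOpp x) x) TZero
| lpa_scaleA a b x : lpa_eq (TScale a (TScale b x)) (TScale (a * b) x)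
| lpa_scale1 x : lpa_eq (TScale 1 x) x
| lpa_scaleDr a x y :
    lpa_eq (TScale a (TAdd x y)) (TAdd (TScale a x) (TScale a y))
| lpa_scaleDl a b x :
    lpa_eq (TScale (a + b) x) (TAdd (TScale a x) (TScale b x))
| lpa_mulA x y z : lpa_eq (TMul x (TMul y z)) (TMul (TMul x y) z)
| lpa_mulDl x y z : lpa_eq (TMul (TAdd x y) z) (TAdd (TMul x z) (TMul y z))
| lpa_mulDr x y z : lpa_eq (TMul x (TAdd y z)) (TAdd (TMul x y) (TMul x z))
| lpa_scaleAl a x y : lpa_eq (TMul (TScale a x) y) (TScale a (TMul x y))
| lpa_scaleAr a x y : lpa_eq (TMul x (TScale a y)) (TScale a (TMul x y))
| lpa_V_eq v : lpa_eq (TMul (TVertex v) (TVertex v)) (TVertex v)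
| lpa_V_neq v w : v <> w -> lpa_eq (TMul (TVertex v) (TVertex w)) TZero
| lpa_P1_source e : lpa_eq (TMul (TVertex (src e)) (TEdge e)) (TEdge e)
| lpa_P1_range e : lpa_eq (TMul (TEdge e) (TVertex (rng e))) (TEdge e)
| lpa_P2_range e : lpa_eq (TMul (TVertex (rng e)) (TGhost e)) (TGhost e)
| lpa_P2_source e : lpa_eq (TMul (TGhost e) (TVertex (src e))) (TGhost e)
| lpa_CK1_eq e : lpa_eq (TMul (TGhost e) (TEdge e)) (TVertex (rng e))
| lpa_CK1_neq e f : e <> f -> lpa_eq (TMul (TGhost e) (TEdge f)) TZero
(* CK2: es enumerates the finite non-empty set of edges emitted by v *)
| lpa_CK2 v (es : seq (edge E)) :
    List.NoDup es -> (forall e, List.In e es <-> src e = v) -> es <> [::] ->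
    lpa_eq (TVertex v) (term_sum [seq TMul (TEdge e) (TGhost e) | e <- es]).

HB.instance Definition _ := gen_eqMixin lpa_term.
HB.instance Definition _ := gen_choiceMixin lpa_term.

Definition lpa_eqb : rel lpa_term := fun x y => `[< lpa_eq x y >].

Lemma lpa_eqb_refl : reflexive lpa_eqb.
Proof. by move=> x; apply/asboolP; apply: lpa_refl. Qed.

Lemma lpa_eqb_sym : symmetric lpa_eqb.
Proof. by move=> x y; apply/asboolP/asboolP; apply: lpa_sym. Qed.

Lemma lpa_eqb_trans : transitive lpa_eqb.
Proof.
by move=> y x z /asboolP xy /asboolP yz; apply/asboolP; apply: lpa_trans yz.
Qed.

Canonical lpa_equiv := EquivRel lpa_eqb lpa_eqb_refl lpa_eqb_sym lpa_eqb_trans.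

Definition lpa : Type := {eq_quot lpa_equiv}.
HB.instance Definition _ : EqQuotient _ lpa_equiv lpa :=
  EqQuotient.on lpa.
HB.instance Definition _ := Choice.on lpa.

Lemma lpa_piP x y : \pi_lpa x = \pi_lpa y <-> lpa_eq x y.
Proof.
by split=> [/eqmodP/asboolP //|xy]; apply/eqmodP; apply/asboolP.
Qed.

Lemma lpa_repr x : lpa_eq (repr (\pi_lpa x)) x.
Proof. by apply/lpa_piP; rewrite reprK. Qed.

Definition lpa_zero : lpa := \pi_lpa TZero.
Definition lpa_opp (x : lpa) : lpa := \pi_lpa (TOpp (repr x)).
Definition lpa_add (x y : lpa) : lpa := \pi_lpa (TAdd (repr x) (repr y)).
Definition lpa_mul (x y : lpa) : lpa := \pi_lpa (TMul (repr x) (repr y)).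
Definition lpa_scale (k : K) (x : lpa) : lpa := \pi_lpa (TScale k (repr x)).

Lemma lpa_piN x : \pi_lpa (TOpp x) = lpa_opp (\pi_lpa x).
Proof. by apply/lpa_piP/lpa_congrN/lpa_sym/lpa_repr. Qed.

Lemma lpa_piD x y : \pi_lpa (TAdd x y) = lpa_add (\pi_lpa x) (\pi_lpa y).
Proof. by apply/lpa_piP/lpa_congrD; apply/lpa_sym/lpa_repr. Qed.

Lemma lpa_piM x y : \pi_lpa (TMul x y) = lpa_mul (\pi_lpa x) (\pi_lpa y).
Proof. by apply/lpa_piP/lpa_congrM; apply/lpa_sym/lpa_repr. Qed.

Lemma lpa_piZ k x : \pi_lpa (TScale k x) = lpa_scale k (\pi_lpa x).
Proof. by apply/lpa_piP/lpa_congrZ/lpa_sym/lpa_repr. Qed.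

Lemma lpa_addrA : associative lpa_add.
Proof.
elim/quotW=> x; elim/quotW=> y; elim/quotW=> z.
by rewrite -(lpa_piD y) -(lpa_piD x y) -!lpa_piD; apply/lpa_piP/lpa_addA.
Qed.

Lemma lpa_addrC : commutative lpa_add.
Proof.
elim/quotW=> x; elim/quotW=> y.
by rewrite -!lpa_piD; apply/lpa_piP/lpa_addC.
Qed.

Lemma lpa_add0r : left_id lpa_zero lpa_add.
Proof.
by elim/quotW=> x; rewrite -lpa_piD; apply/lpa_piP/lpa_add0.
Qed.

Lemma lpa_addNr : left_inverse lpa_zero lpa_opp lpa_add.
Proof.
by elim/quotW=> x; rewrite -lpa_piN -lpa_piD; apply/lpa_piP/lpa_addN.
Qed.

HB.instance Definition _ :=
  GRing.isZmodule.Build lpa lpa_addrA lpa_addrC lpa_add0r lpa_addNr.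

Lemma lpa_pi_add x y : \pi_lpa (TAdd x y) = \pi_lpa x + \pi_lpa y.
Proof. exact: lpa_piD. Qed.

Lemma lpa_scalerA a b (x : lpa) :
  lpa_scale a (lpa_scale b x) = lpa_scale (a * b) x.
Proof.
by elim/quotW: x => x; rewrite -(lpa_piZ b) -!lpa_piZ; apply/lpa_piP/lpa_scaleA.
Qed.

Lemma lpa_scale1r : left_id 1 lpa_scale.
Proof. by elim/quotW=> x; rewrite -lpa_piZ; apply/lpa_piP/lpa_scale1. Qed.

Lemma lpa_scalerDr : right_distributive lpa_scale +%R.
Proof.
move=> a; elim/quotW=> x; elim/quotW=> y.
by rewrite -lpa_pi_add -!lpa_piZ -lpa_pi_add; apply/lpa_piP/lpa_scaleDr.
Qed.

Lemma lpa_scalerDl (x : lpa) : {morph lpa_scale^~ x : a b / a + b}.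
Proof.
elim/quotW: x => x a b.
by rewrite -!lpa_piZ -lpa_pi_add; apply/lpa_piP/lpa_scaleDl.
Qed.

HB.instance Definition _ := GRing.Zmodule_isLmodule.Build K lpa
  lpa_scalerA lpa_scale1r lpa_scalerDr lpa_scalerDl.

Lemma lpa_pi_scale k x : \pi_lpa (TScale k x) = k *: \pi_lpa x.
Proof. exact: lpa_piZ. Qed.

Lemma lpa_mulrA : associative lpa_mul.
Proof.
elim/quotW=> x; elim/quotW=> y; elim/quotW=> z.
by rewrite -(lpa_piM y) -(lpa_piM x y) -!lpa_piM; apply/lpa_piP/lpa_mulA.
Qed.

Lemma lpa_mulrDl : left_distributive lpa_mul +%R.
Proof.
elim/quotW=> x; elim/quotW=> y; elim/quotW=> z.
by rewrite -lpa_pi_add -!lpa_piM -lpa_pi_add; apply/lpa_piP/lpa_mulDl.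
Qed.

Lemma lpa_mulrDr : right_distributive lpa_mul +%R.
Proof.
elim/quotW=> x; elim/quotW=> y; elim/quotW=> z.
by rewrite -lpa_pi_add -!lpa_piM -lpa_pi_add; apply/lpa_piP/lpa_mulDr.
Qed.

Lemma lpa_scalerAl a (x y : lpa) : lpa_mul (a *: x) y = a *: lpa_mul x y.
Proof.
elim/quotW: x => x; elim/quotW: y => y.
by rewrite -lpa_pi_scale -!lpa_piM -lpa_pi_scale; apply/lpa_piP/lpa_scaleAl.
Qed.

Lemma lpa_scalerAr a (x y : lpa) : lpa_mul x (a *: y) = a *: lpa_mul x y.
Proof.
elim/quotW: x => x; elim/quotW: y => y.
by rewrite -lpa_pi_scale -!lpa_piM -lpa_pi_scale; apply/lpa_piP/lpa_scaleAr.
Qed.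

End Presentation.

Arguments TVertex {K E}.
Arguments TEdge {K E}.
Arguments TGhost {K E}.
Arguments TZero {K E}.

Section InducedInvolution.
Variables (K : fieldType) (bar : involution (@GRing.mul K)) (E : digraph).
Local Notation term := (lpa_term K E).
Local Notation L := (lpa K E).

Fixpoint term_star (x : term) : term :=
  match x with
  | TVertex v => TVertex v
  | TEdge e => TGhost e
  | TGhost e => TEdge e
  | TZero => TZero
  | TOpp x => TOpp (term_star x)
  | TAdd x y => TAdd (term_star x) (term_star y)
  | TMul x y => TMul (term_star y) (term_star x)
  | TScale k x => TScale (bar k) (term_star x)
  end.

Lemma inv_one : bar 1 = 1.
Proof. by rewrite -[bar 1]mulr1 -{2}(inv_inv bar 1) -inv_mul mulr1 inv_inv. Qed.

Lemma term_star_eq (x y : term) :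
  lpa_eq x y -> lpa_eq (term_star x) (term_star y).
Proof.
elim=> /=.
- by move=> *; apply: lpa_refl.
- by move=> u v _; apply: lpa_sym.
- by move=> u v w _ uv _; apply: lpa_trans.
- by move=> u u' _; apply: lpa_congrN.
- by move=> u u' v v' _ ? _; apply: lpa_congrD.
- by move=> u u' v v' _ uu' _ vv'; apply: lpa_congrM.
- by move=> k u u' _; apply: lpa_congrZ.
- by move=> *; apply: lpa_addA.
- by move=> *; apply: lpa_addC.
- by move=> *; apply: lpa_add0.
- by move=> *; apply: lpa_addN.
- by move=> a b u; rewrite inv_mul mulrC; apply: lpa_scaleA.
- by move=> u; rewrite inv_one; apply: lpa_scale1.
- by move=> *; apply: lpa_scaleDr.
- by move=> a b u; rewrite inv_add; apply: lpa_scaleDl.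
- by move=> *; apply/lpa_sym/lpa_mulA.
- by move=> *; apply: lpa_mulDr.
- by move=> *; apply: lpa_mulDl.
- by move=> *; apply: lpa_scaleAr.
- by move=> *; apply: lpa_scaleAl.
- by move=> *; apply: lpa_V_eq.
- by move=> v w /nesym; apply: lpa_V_neq.
- by move=> *; apply: lpa_P2_source.
- by move=> *; apply: lpa_P2_range.
- by move=> *; apply: lpa_P1_range.
- by move=> *; apply: lpa_P1_source.
- by move=> *; apply: lpa_CK1_eq.
- by move=> e f /nesym; apply: lpa_CK1_neq.
- move=> v es es_uniq es_v es0; apply: lpa_trans (lpa_CK2 K es_uniq es_v es0) _.
  rewrite /term_sum; elim: es {es_uniq es_v es0} => [|e es IH] /=.
    exact: lpa_refl.
  by apply: lpa_congrD => //; apply: lpa_refl.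
Qed.

Lemma term_starK : involutive term_star.
Proof.
elim=> //= [x ->|x -> y ->|x -> y ->|k x ->] //.
by rewrite inv_inv.
Qed.

Definition lpa_star_fun (x : L) : L := \pi_L (term_star (repr x)).

Lemma lpa_pi_star x : \pi_L (term_star x) = lpa_star_fun (\pi_L x).
Proof. by apply/lpa_piP/term_star_eq/lpa_sym/lpa_repr. Qed.

Lemma lpa_star_add : {morph lpa_star_fun : x y / x + y}.
Proof.
elim/quotW=> x; elim/quotW=> y.
by rewrite -lpa_pi_add -!lpa_pi_star -lpa_pi_add.
Qed.

Lemma lpa_star_mul (x y : L) :
  lpa_star_fun (lpa_mul x y) = lpa_mul (lpa_star_fun y) (lpa_star_fun x).
Proof.
elim/quotW: x => x; elim/quotW: y => y.
by rewrite -lpa_piM -!lpa_pi_star -lpa_piM.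
Qed.

Lemma lpa_star_inv : involutive lpa_star_fun.
Proof. by elim/quotW=> x; rewrite -(lpa_pi_star x) -lpa_pi_star term_starK. Qed.

Definition lpa_star : involution (@lpa_mul K E) :=
  Involution lpa_star_add lpa_star_mul lpa_star_inv.

End InducedInvolution.

(* lpa_span and lpa_star_sum below identify lpa_star with the unique map that
   sends every sum of k p q^* to the sum of (bar k) q p^*, for paths p, q. *)

Section Paths.
Variables (K : fieldType) (E : digraph).
Local Notation L := (lpa K E).
Local Notation "x ** y" := (lpa_mul x y) (at level 40, left associativity).

Definition lpa_vertex (v : vertex E) : L := \pi_L (TVertex v).
Definition lpa_edge (e : edge E) : L := \pi_L (TEdge e).
Definition lpa_ghost (e : edge E) : L := \pi_L (TGhost e).

Inductive path_between : vertex E -> vertex E -> Type :=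
| path_nil v : path_between v v
| path_cons e w : path_between (rng e) w -> path_between (src e) w.

Record gpath := GPath {
  path_source : vertex E;
  path_range : vertex E;
  path_edges :> path_between path_source path_range }.

(* A path e_1 ... e_n of positive length is sent to e_1 ... e_n r(e_n), which
   equals e_1 ... e_n in L. *)
Fixpoint lpa_path_between v w (p : path_between v w) : L :=
  match p with
  | path_nil v => lpa_vertex v
  | path_cons e _ p => lpa_edge e ** lpa_path_between p
  end.

Fixpoint lpa_path_between_ghost v w (p : path_between v w) : L :=
  match p with
  | path_nil v => lpa_vertex v
  | path_cons e _ p => lpa_path_between_ghost p ** lpa_ghost e
  end.

Definition lpa_path (p : gpath) : L := lpa_path_between p.
Definition lpa_path_ghost (p : gpath) : L := lpa_path_between_ghost p.

Lemma lpa_star_path (bar : involution (@GRing.mul K)) (p : gpath) :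
  lpa_star bar E (lpa_path p) = lpa_path_ghost p.
Proof.
case: p => v w p; rewrite /lpa_path /lpa_path_ghost /=.
elim: p => [u|e u p IH] /=; first by rewrite -lpa_pi_star.
by rewrite lpa_star_mul IH; congr (_ ** _); rewrite -lpa_pi_star.
Qed.

Lemma lpa_star_sum (bar : involution (@GRing.mul K))
    (s : seq (K * gpath * gpath)) :
  lpa_star bar E (\sum_(m <- s) m.1.1 *: (lpa_path m.1.2 ** lpa_path_ghost m.2))
  = \sum_(m <- s) bar m.1.1 *: (lpa_path m.2 ** lpa_path_ghost m.1.2).
Proof.
have starZ k (x : L) : lpa_star bar E (k *: x) = bar k *: lpa_star bar E x.
  elim/quotW: x => x.
  by rewrite -lpa_pi_scale /= -!lpa_pi_star -lpa_pi_scale.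
elim: s => [|m s IH]; last first.
  by rewrite !big_cons inv_add IH starZ inv_mul -!(lpa_star_path bar) inv_inv.
rewrite !big_nil; apply: (@addrI _ (lpa_star bar E 0)).
by rewrite -inv_add !addr0.
Qed.

Lemma lpa_span (x : L) : exists s : seq (K * gpath * gpath),
  x = \sum_(m <- s) m.1.1 *: (lpa_path m.1.2 ** lpa_path_ghost m.2).
Proof.
pose spanned (x : L) := exists s : seq (K * gpath * gpath),
  x = \sum_(m <- s) m.1.1 *: (lpa_path m.1.2 ** lpa_path_ghost m.2).
rewrite -/(spanned x).
have spanD y z : spanned y -> spanned z -> spanned (y + z).
  by move=> [s ->] [t ->]; exists (s ++ t); rewrite big_cat.
have spanZ k y : spanned y -> spanned (k *: y).
  move=> [s ->]; exists [seq (k * m.1.1, m.1.2, m.2) | m <- s].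
  by rewrite big_map scaler_sumr; apply: eq_bigr => m _; rewrite scalerA.
have span0 : spanned 0 by exists [::]; rewrite big_nil.
have span1 p q : spanned (lpa_path p ** lpa_path_ghost q).
  by exists [:: (1, p, q)]; rewrite big_seq1 scale1r.
have piE (a b : lpa_term K E) : lpa_eq a b -> \pi_L a = \pi_L b.
  by move/lpa_piP.
have VV v : lpa_vertex v ** lpa_vertex v = lpa_vertex v.
  by rewrite -lpa_piM; apply/piE/lpa_V_eq.
have VVn v w : v <> w -> lpa_vertex v ** lpa_vertex w = 0.
  by rewrite -lpa_piM => vw; apply/piE/lpa_V_neq.
have sE e : lpa_vertex (src e) ** lpa_edge e = lpa_edge e.
  by rewrite -lpa_piM; apply/piE/lpa_P1_source.
have Er e : lpa_edge e ** lpa_vertex (rng e) = lpa_edge e.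
  by rewrite -lpa_piM; apply/piE/lpa_P1_range.
have rG e : lpa_vertex (rng e) ** lpa_ghost e = lpa_ghost e.
  by rewrite -lpa_piM; apply/piE/lpa_P2_range.
have Gs e : lpa_ghost e ** lpa_vertex (src e) = lpa_ghost e.
  by rewrite -lpa_piM; apply/piE/lpa_P2_source.
have GE e : lpa_ghost e ** lpa_edge e = lpa_vertex (rng e).
  by rewrite -lpa_piM; apply/piE/lpa_CK1_eq.
have GEn e f : e <> f -> lpa_ghost e ** lpa_edge f = 0.
  by rewrite -lpa_piM => ef; apply/piE/lpa_CK1_neq.
have mul0 (y : L) : 0 ** y = 0.
  by apply: (@addrI _ (0 ** y)); rewrite -lpa_mulrDl !addr0.
have mul0' (y : L) : y ** 0 = 0.
  by apply: (@addrI _ (y ** 0)); rewrite -lpa_mulrDr !addr0.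
have sP v w (p : path_between v w) :
    lpa_vertex v ** lpa_path_between p = lpa_path_between p.
  by case: p => [u|e u p] /=; rewrite ?VV // lpa_mulrA sE.
have rPg v w (p : path_between v w) :
    lpa_vertex w ** lpa_path_between_ghost p = lpa_path_between_ghost p.
  by elim: p => [u|e u p IH] /=; rewrite ?VV // lpa_mulrA IH.
have rcons_ghost v w (p : path_between v w) e : w = src e ->
    exists p' : path_between v (rng e),
      lpa_path_between_ghost p' = lpa_ghost e ** lpa_path_between_ghost p.
  elim: p => [u ->|f u p IH /IH [p' p'E]].
    by exists (path_cons (path_nil (rng e))); rewrite /= rG Gs.
  by exists (path_cons p'); rewrite /= p'E lpa_mulrA.
have spanE (y z : L) :
    (forall p q, spanned (y ** (lpa_path p ** lpa_path_ghost q))) ->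
    spanned z -> spanned (y ** z).
  move=> H [s ->]; elim: s => [|m s IH]; first by rewrite big_nil mul0'.
  by rewrite big_cons lpa_mulrDr lpa_scalerAr; apply: (spanD _ _ (spanZ _ _ _)).
have lV v z : spanned z -> spanned (lpa_vertex v ** z).
  apply: spanE => -[u w p] q.
  rewrite lpa_mulrA /lpa_path /= -sP lpa_mulrA.
  case: (pselect (v = u)) => [->|/VVn ->]; last by rewrite !mul0.
  by rewrite VV sP; apply: (span1 (GPath p)).
have lE e z : spanned z -> spanned (lpa_edge e ** z).
  apply: spanE => -[u w p] q.
  rewrite lpa_mulrA /lpa_path /=.
  case: (pselect (rng e = u)) => [eu|/VVn eu].
    by subst u; apply: (span1 (GPath (path_cons p))).
  by rewrite -(sP _ _ p) -(Er e) -(lpa_mulrA (lpa_edge e))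
             (lpa_mulrA (lpa_vertex (rng e))) eu mul0 mul0' mul0.
have lG e z : spanned z -> spanned (lpa_ghost e ** z).
  apply: spanE => -[u w p] q.
  rewrite lpa_mulrA /lpa_path /=.
  case: p => [u'|f u' p] /=.
    case: (pselect (src e = u')) => [<-|/VVn eu]; last first.
      by rewrite -(Gs e) -(lpa_mulrA (lpa_ghost e)) eu mul0' mul0.
    rewrite Gs; case: q => v' w' q; rewrite /lpa_path_ghost /=.
    case: (pselect (src e = w')) => [ew|/VVn ew]; last first.
      by rewrite -(rPg _ _ q) -(Gs e) -(lpa_mulrA (lpa_ghost e))
                 (lpa_mulrA (lpa_vertex (src e))) ew mul0 mul0'.
    have [p <-] := rcons_ghost _ _ q e (esym ew).
    have -> : lpa_path_between_ghost p = lpa_path (GPath (path_nil (rng e)))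
                                         ** lpa_path_ghost (GPath p).
      by rewrite /lpa_path /= rPg.
    exact: span1.
  case: (pselect (e = f)) => [->|/GEn ef]; rewrite lpa_mulrA.
    by rewrite GE sP; apply: (span1 (GPath p)).
  by rewrite ef !mul0.
have sV v : spanned (lpa_vertex v).
  by rewrite -VV; apply: (span1 (GPath (path_nil v)) (GPath (path_nil v))).
suff main (t : lpa_term K E) :
    spanned (\pi_L t) /\ forall z, spanned z -> spanned ((\pi_L t : L) ** z).
  by elim/quotW: x => t; case: (main t).
elim: t => [v|e|e||t [sp m]|t [sp m] u [sp' m']|t [sp m] u [sp' m']|k t [sp m]].
- by split=> [|z]; [apply: sV|apply: lV].
- by split=> [|z]; [rewrite -[\pi_L _]Er; apply/lE/sV|apply: lE].
- by split=> [|z]; [rewrite -[\pi_L _]Gs; apply/lG/sV|apply: lG].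
- by split=> [|z _]; rewrite ?mul0; apply: span0.
- have oppE : \pi_L (TOpp t) = -1 *: (\pi_L t : L) by rewrite scaleN1r lpa_piN.
  by rewrite oppE; split=> [|z /m ?]; rewrite ?lpa_scalerAl; apply: spanZ.
- rewrite lpa_pi_add; split=> [|z sz]; first exact: spanD.
  by rewrite lpa_mulrDl; apply: spanD; [apply: m|apply: m'].
- rewrite lpa_piM; split=> [|z sz]; first exact: m.
  by rewrite -lpa_mulrA; apply/m/m'.
- rewrite lpa_pi_scale.
  by split=> [|z /m ?]; rewrite ?lpa_scalerAl; apply: spanZ.
Qed.

End Paths.

(* Main.v *)
(* L_K(E) acts on K-valued functions on the boundary paths of E, each boundary
   path carrying an integer level that the edges raise and the ghost edges lower
   by one. The generators act by partial bijections of the points, so the action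
   turns * into the adjoint for the inner product
   <phi, psi> = sum_x bar(phi x) psi x. This inner product is definite on finitely
   supported functions because bar is positive definite. Thus x^* x = 0 forces
   <x d_z, x d_z> = <d_z, x^* x d_z> = 0 for every point mass d_z, hence x d_z = 0,
   and x = 0 follows once the action is known to be faithful.

   For faithfulness, CK2 lets one write x as a combination of monomials p q^* where
   either q has a fixed length N, or q is shorter and its range is not regular.
   Take p0 q0^* with q0 of minimal length among the q's with nonzero coefficients.
   Extend q0 by a boundary path b which, if r(q0) is not regular, stops at once. In
   x d_(q0 b), the point p0 b only receives the coefficient of p0 q0^*; the levels
   distinguish p0 b from p b when p and p0 have different lengths. *)

Require Import Defs.
From HB Require Import structures.
From mathcomp Require Import all_boot all_algebra.
From mathcomp Require Import boolp classical_sets fsbigop.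
From Stdlib Require List.
From mathcomp Require Import zify.

Set Implicit Arguments.
Unset Strict Implicit.
Unset Printing Implicit Defensive.

Import GRing.Theory.
Local Open Scope ring_scope.
Local Open Scope quotient_scope.

(** * Finitely supported functions, their inner product and partial bijections *)

Lemma bar0 (K : fieldType) (bar : involution (@GRing.mul K)) : bar 0 = 0.
Proof. by apply: (@addrI _ (bar 0)); rewrite -inv_add !addr0. Qed.

Section FinitelySupported.
Variables (K : fieldType) (bar : involution (@GRing.mul K)) (T : choiceType).
Implicit Types (phi psi : T -> K) (P Q : T -> Prop) (h k : T -> T).

Definition fin_supp phi := exists r : seq T, forall x, x \notin r -> phi x = 0.

(** A sum with infinitely many nonzero terms takes the default value 0, so additivity needs a
    finitely supported argument. *)
Definition inner phi psi : K := \sum_(x \in [set: T]) bar (phi x) * psi x.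

Lemma innerE phi psi (r : seq T) : uniq r ->
  (forall x, x \notin r -> phi x = 0) ->
  inner phi psi = \sum_(x <- r) bar (phi x) * psi x.
Proof.
move=> r_uniq phi0; rewrite /inner (fsbigE r) //; last first.
  by move=> x _ /phi0 ->; rewrite bar0 mul0r.
by apply: eq_bigl => x; rewrite in_setT.
Qed.

Lemma inner_Dl phi1 phi2 psi : fin_supp phi1 -> fin_supp phi2 ->
  inner (fun x => phi1 x + phi2 x) psi = inner phi1 psi + inner phi2 psi.
Proof.
move=> [r1 z1] [r2 z2]; pose r := undup (r1 ++ r2).
have u : uniq r by apply: undup_uniq.
have y1 x : x \notin r -> phi1 x = 0.
  by rewrite mem_undup mem_cat negb_or => /andP[/z1].
have y2 x : x \notin r -> phi2 x = 0.
  by rewrite mem_undup mem_cat negb_or => /andP[_ /z2].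
rewrite !(innerE _ u) //; last by move=> x xr; rewrite y1 // y2 // addr0.
by rewrite -big_split /=; apply: eq_bigr => x _; rewrite inv_add mulrDl.
Qed.

Lemma inner_Dr phi psi1 psi2 : fin_supp phi ->
  inner phi (fun x => psi1 x + psi2 x) = inner phi psi1 + inner phi psi2.
Proof.
move=> [r z]; have u := undup_uniq r.
have y x : x \notin undup r -> phi x = 0 by rewrite mem_undup => /z.
rewrite !(innerE _ u) // -big_split /=.
by apply: eq_bigr => x _; rewrite mulrDr.
Qed.

(** On a duplicate-free list [r] containing the support, the inner product is a sum of [size r]
    terms [bar a * a], so [n_proper] applies with [n = size r]; this is positive because [r]
    contains [x]. *)
Lemma inner_definite phi : positive_definite_involution bar ->
  fin_supp phi -> inner phi phi = 0 -> forall x, phi x = 0.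
Proof.
move=> pos [r z]; have u := undup_uniq r.
have y x : x \notin undup r -> phi x = 0 by rewrite mem_undup => /z.
rewrite (innerE _ u) //; move: (undup r) y => {z u} {}r y s0 x.
have [xr|/y //] := boolP (x \in r).
have r_gt0 : (0 < size r)%N by case: (r) xr.
move: s0; rewrite (big_nth x) big_mkord.
move/(pos _ r_gt0 (fun i : 'I_(size r) => phi (nth x r i))).
have lt : (index x r < size r)%N by rewrite index_mem.
by move/(_ (Ordinal lt)) => /=; rewrite nth_index.
Qed.

Definition pull P h phi x : K := if `[< P x >] then phi (h x) else 0.

Definition partial_inverse P h Q k := forall x, P x -> Q (h x) /\ k (h x) = x.

Lemma pull_fin_supp P h Q k phi : partial_inverse P h Q k ->
  fin_supp phi -> fin_supp (pull P h phi).
Proof.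
move=> hk [r z]; exists [seq k x | x <- r] => x xr; rewrite /pull.
case: asboolP => // /hk[_ kh]; apply: z; apply: contraNN xr => hx.
by rewrite -kh; apply: map_f.
Qed.

(** The adjoint of a partial bijection is its inverse: both sums reduce to the domains [P] and [Q],
    which [k] matches up. *)
Lemma inner_pull P h Q k phi psi :
  partial_inverse P h Q k -> partial_inverse Q k P h ->
  inner (pull P h phi) psi = inner phi (pull Q k psi).
Proof.
move=> hk kh; rewrite /inner.
rewrite -(fsbig_widen P) //; last first.
  by move=> x [_ nP] /=; rewrite /pull asboolF // bar0 mul0r.
rewrite -[RHS](fsbig_widen Q) //; last first.
  by move=> x [_ nQ] /=; rewrite /pull asboolF // mulr0.
rewrite (@reindex_fsbig _ _ _ _ _ k Q P); last first.
  split=> [x /kh[]//|x y /set_mem/kh[_ {2}<-] /set_mem/kh[_ {2}<-] -> //|x /hk[Qx kx]].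
  by exists (h x).
apply: eq_fsbigr => x /set_mem Qx; have [Px hx] := kh _ Qx.
by rewrite /pull !asboolT // hx.
Qed.

End FinitelySupported.

(** * The representation on boundary paths *)

Section Representation.
Variables (K : fieldType) (E : digraph).
Local Notation term := (lpa_term K E).
Local Notation L := (lpa K E).

Definition enumerates (es : seq (edge E)) (v : vertex E) :=
  [/\ List.NoDup es, forall e, List.In e es <-> src e = v & es <> [::] ].

Definition regular v := exists es, enumerates es v.

(* A boundary path is a sequence of nodes: inr e follows the edge e, and inl v
   stops at the non-regular vertex v. The nodes after a stop are unconstrained:
   the relations of L only need x |-> pcons e x to be a bijection from the points
   that start at rng e to the points whose first node is inr e, and every point
   that starts at a regular vertex to begin with an edge. *)
Definition node := (vertex E + edge E)%type.

Definition node_src (x : node) := match x with inl v => v | inr e => src e end.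

Definition point : Type := ((nat -> node) * int)%type.
HB.instance Definition _ := gen_eqMixin point.
HB.instance Definition _ := gen_choiceMixin point.
Implicit Types (x y : point) (phi psi : point -> K).

Definition start x := node_src (x.1 0%N).

Definition valid x := forall i,
  match x.1 i with
  | inl v => ~ regular v
  | inr e => node_src (x.1 i.+1) = rng e
  end.

Definition pcons e x : point :=
  ((fun i => if i is j.+1 then x.1 j else inr e), x.2 + 1).

Definition ptail x : point := ((fun i => x.1 i.+1), x.2 - 1).

Lemma pconsK e : cancel (pcons e) ptail.
Proof. by case=> f n; rewrite /pcons /ptail /= addrK. Qed.

Lemma ptailK e x : x.1 0%N = inr e -> pcons e (ptail x) = x.
Proof.
case: x => f n /= fe; rewrite /pcons /ptail /= subrK; congr (_, _).
by apply/funext; case.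
Qed.

Lemma valid_pcons e x : valid (pcons e x) <-> valid x /\ start x = rng e.
Proof.
split=> [v|[v s] [|i] //]; last exact: v.
by split=> [i|]; [exact: (v i.+1)|exact: (v 0%N)].
Qed.

Lemma valid_ptail x : valid x -> valid (ptail x).
Proof. by move=> v i; apply: (v i.+1). Qed.

Definition at_vertex v x := valid x /\ start x = v.
Definition at_edge e x := valid x /\ x.1 0%N = inr e.

(** Pulling back along [ptail] pushes point masses forward: [TEdge e] moves the mass at a valid [z]
    starting at [rng e] to [pcons e z], and [TGhost e] removes a leading [e]. *)
Fixpoint act (t : term) phi : point -> K :=
  match t with
  | TVertex v => pull (at_vertex v) id phi
  | TEdge e => pull (at_edge e) ptail phi
  | TGhost e => pull (at_vertex (rng e)) (pcons e) phi
  | TZero => fun=> 0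
  | TOpp t => fun x => - act t phi x
  | TAdd t u => fun x => act t phi x + act u phi x
  | TMul t u => act t (act u phi)
  | TScale k t => fun x => k * act t phi x
  end.

Lemma pinv_vertex v : partial_inverse (at_vertex v) id (at_vertex v) id.
Proof. by []. Qed.

Lemma pinv_edge e :
  partial_inverse (at_edge e) ptail (at_vertex (rng e)) (pcons e).
Proof.
move=> x [vx xe]; rewrite ptailK //; split=> //; apply/valid_pcons.
by rewrite ptailK.
Qed.

Lemma pinv_ghost e :
  partial_inverse (at_vertex (rng e)) (pcons e) (at_edge e) ptail.
Proof. by move=> x /valid_pcons vx; rewrite pconsK. Qed.

Lemma act_fin_supp t phi : fin_supp phi -> fin_supp (act t phi).
Proof.
elim: t phi => [v|e|e||t IH|t IHt u IHu|t IHt u IHu|k t IH] phi fphi /=.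
- exact: pull_fin_supp (@pinv_vertex v) fphi.
- exact: pull_fin_supp (@pinv_edge e) fphi.
- exact: pull_fin_supp (@pinv_ghost e) fphi.
- by exists [::].
- by have [r z] := IH _ fphi; exists r => x /z ->; rewrite oppr0.
- have [[r z] [r' z']] := (IHt _ fphi, IHu _ fphi); exists (r ++ r') => x.
  by rewrite mem_cat negb_or => /andP[/z -> /z' ->]; rewrite addr0.
- exact/IHt/IHu.
- by have [r z] := IH _ fphi; exists r => x /z ->; rewrite mulr0.
Qed.

Lemma act_add t phi psi :
  act t (fun x => phi x + psi x) = (fun x => act t phi x + act t psi x).
Proof.
have pullD P h (f g : point -> K) :
    pull P h (fun x => f x + g x) = (fun x => pull P h f x + pull P h g x).
  by apply/funext => x; rewrite /pull; case: ifP; rewrite ?addr0.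
elim: t phi psi => [v|e|e||t IH|t IHt u IHu|t IHt u IHu|k t IH] phi psi /=;
  rewrite ?pullD ?IHt ?IHu ?IH //; apply/funext => x.
- by rewrite addr0.
- by rewrite opprD.
- by rewrite addrACA.
- by rewrite mulrDr.
Qed.

Lemma act_scale t k phi : act t (fun x => k * phi x) = (fun x => k * act t phi x).
Proof.
have pullZ P h (f : point -> K) :
    pull P h (fun x => k * f x) = (fun x => k * pull P h f x).
  by apply/funext => x; rewrite /pull; case: ifP; rewrite ?mulr0.
elim: t phi => [v|e|e||t IH|t IHt u IHu|t IHt u IHu|l t IH] phi /=;
  rewrite ?pullZ ?IHt ?IHu ?IH //; apply/funext => x.
- by rewrite mulr0.
- by rewrite mulrN.
- by rewrite mulrDr.
- by rewrite mulrCA.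
Qed.

Lemma inner_act (bar : involution (@GRing.mul K)) t phi psi :
  fin_supp phi -> fin_supp psi ->
  inner bar (act t phi) psi = inner bar phi (act (term_star bar t) psi).
Proof.
elim: t phi psi => [v|e|e||t IH|t IHt u IHu|t IHt u IHu|k t IH] phi psi f1 f2 /=.
- by apply: inner_pull; apply: pinv_vertex.
- by apply: inner_pull; [apply: pinv_edge|apply: pinv_ghost].
- by apply: inner_pull; [apply: pinv_ghost|apply: pinv_edge].
- by rewrite /inner !fsbig1 // => x _; rewrite ?bar0 ?mul0r ?mulr0.
- have f3 : fin_supp (fun x => - act t phi x).
    exact: (act_fin_supp (TOpp t)).
  have f4 := act_fin_supp t f1.
  (* Added to the value for [t], both sides become 0 by additivity. *)
  apply: (@addrI _ (inner bar (act t phi) psi)).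
  rewrite -inner_Dl // [X in _ = X + _]IH // -inner_Dr //.
  by rewrite /inner !fsbig1 // => x _; rewrite ?subrr ?bar0 ?mul0r ?mulr0.
- by rewrite inner_Dl ?inner_Dr ?IHt ?IHu //; apply: act_fin_supp.
- by rewrite IHt ?IHu //; apply: act_fin_supp.
- transitivity (inner bar (act t phi) (fun x => bar k * psi x)).
    by apply: eq_fsbigr => x _; rewrite inv_mul -mulrA.
  have f3 : fin_supp (fun x => bar k * psi x).
    by case: f2 => r z; exists r => x /z ->; rewrite mulr0.
  by rewrite IH //; apply: eq_fsbigr => x _; rewrite act_scale.
Qed.

(** This reduces the multiplicative relations between generators to comparing domains and maps. *)
Lemma pull_comp P h Q k phi :
  pull P h (pull Q k phi) = pull (fun x => P x /\ Q (h x)) (k \o h) phi.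
Proof.
apply/funext => x; rewrite /pull /=; case: asboolP => [Px|nP]; last first.
  by rewrite asboolF // => -[].
by case: asboolP => Qx; [rewrite asboolT|rewrite asboolF // => -[]].
Qed.

Lemma eq_pull P Q h k phi :
  (forall x, P x <-> Q x) -> (forall x, P x -> h x = k x) ->
  pull P h phi = pull Q k phi.
Proof.
move=> PQ hk; apply/funext => x; rewrite /pull.
by case: asboolP => [Px|nP]; [rewrite hk // asboolT //|rewrite asboolF //];
  rewrite -PQ.
Qed.

Lemma pull0 P h phi : (forall x, ~ P x) -> pull P h phi = fun=> 0.
Proof. by move=> nP; apply/funext => x; rewrite /pull asboolF. Qed.

(** No valid point stops at a regular vertex, so those starting at [v] are split by their first
    edge; each [e e^*] projects onto one piece. *)
Lemma act_CK2 v es phi : enumerates es v ->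
  act (term_sum [seq TMul (TEdge e) (TGhost e) | e <- es]) phi
  = act (TVertex v) phi.
Proof.
move=> [es_uniq es_v es0]; have reg : regular v by exists es.
have -> : act (TVertex v) phi
    = pull (fun x => exists e, List.In e es /\ at_edge e x) id phi.
  apply: eq_pull => // x; split=> [[vx xv]|[e [/es_v ev [vx xe]]]]; last first.
    by split=> //; rewrite /start xe.
  have := vx 0%N; move: xv; rewrite /start.
  case xe: (x.1 0%N) => [w|e] /= => [->|ev _]; first by move/(_ reg).
  by exists e; split=> //; apply/es_v.
elim: es es_uniq {es_v es0 reg} => [_|e es IH u] /=.
  by rewrite pull0 // => x [e []].
apply/funext => x; inversion_clear u as [|? ? nin uniq]; rewrite IH //.
rewrite pull_comp /pull /=.
have eE : at_edge e x /\ at_vertex (rng e) (ptail x) <-> at_edge e x.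
  by split=> [[]//|xe]; have [] := pinv_edge xe.
case: asboolP => [/eE xe|/eE xe]; last first.
  rewrite add0r; congr (if _ then _ else _); apply: asbool_equiv_eq.
  split=> [[f [? ?]]|[f [[<-//|? ?]]]]; exists f; split=> //; by right.
(* Here [x] begins with [e], and by [NoDup] no later edge of the list equals [e], so the rest of the
   sum vanishes at [x]. *)
rewrite asboolF ?addr0 => [|[f [fes xf]]]; last first.
  by case: nin; case: xe xf => _ xe [_]; rewrite xe => -[->].
rewrite asboolT; last by exists e; split; [left|].
by rewrite ptailK //; case: xe.
Qed.

Lemma act_lpa_eq t u : lpa_eq t u -> forall phi, act t phi = act u phi.
Proof.
elim.
- by [].
- by move=> *; symmetry.
- by move=> a b c _ ab _ bc phi; rewrite ab.
- by move=> a b _ ab phi /=; rewrite ab.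
- by move=> a a' b b' _ aa' _ bb' phi /=; rewrite aa' bb'.
- by move=> a a' b b' _ aa' _ bb' phi /=; rewrite aa' bb'.
- by move=> k a a' _ aa' phi /=; rewrite aa'.
- by move=> a b c phi /=; apply/funext => x; rewrite addrA.
- by move=> a b phi /=; apply/funext => x; rewrite addrC.
- by move=> a phi /=; apply/funext => x; rewrite add0r.
- by move=> a phi /=; apply/funext => x; rewrite addNr.
- by move=> k l a phi /=; apply/funext => x; rewrite mulrA.
- by move=> a phi /=; apply/funext => x; rewrite mul1r.
- by move=> k a b phi /=; apply/funext => x; rewrite mulrDr.
- by move=> k l a phi /=; apply/funext => x; rewrite mulrDl.
- by [].
- by [].
- by move=> a b c phi /=; rewrite act_add.
- by [].
- by move=> k a b phi /=; rewrite act_scale.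
- by move=> v phi /=; rewrite pull_comp; apply: eq_pull => // x; tauto.
- move=> v w vw phi /=; rewrite pull_comp pull0 // => x [[_ xv] [_ xw]].
  by apply: vw; rewrite -xv.
- move=> e phi /=; rewrite pull_comp; apply: eq_pull => // x.
  by split=> [[]//|[vx xe]]; rewrite /at_vertex /start /= xe.
- move=> e phi /=; rewrite pull_comp; apply: eq_pull => // x.
  by split=> [[]//|xe]; split=> //; case: (pinv_edge xe).
- by move=> e phi /=; rewrite pull_comp; apply: eq_pull => // x; tauto.
- move=> e phi /=; rewrite pull_comp; apply: eq_pull => // x.
  by split=> [[]//|xe]; split=> //; split=> //; apply/valid_pcons.
- move=> e phi /=; rewrite pull_comp; apply: eq_pull => [x|x _ /=].
    by split=> [[]//|xe]; split=> //; case: (pinv_ghost xe).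
  by rewrite pconsK.
- move=> e f ef phi /=; rewrite pull_comp pull0 // => x [_ [_ [fe]]].
  exact: ef.
- by move=> v es es_uniq es_v es0 phi; rewrite (@act_CK2 v).
Qed.

End Representation.

(** * The action of [L], and path identities in [L] *)

Section Faithful.
Variables (K : fieldType) (E : digraph).
Local Notation L := (lpa K E).
Local Notation "x ** y" := (lpa_mul x y) (at level 40, left associativity).
Local Notation V := (@lpa_vertex K E).
Local Notation Ed := (@lpa_edge K E).
Local Notation G := (@lpa_ghost K E).
Implicit Types (a b : L) (phi : point E -> K) (x y z : point E).

Definition lact a phi := act (repr a) phi.

Lemma lact_pi t phi : lact (\pi_L t) phi = act t phi.
Proof. exact/act_lpa_eq/lpa_repr. Qed.

Lemma lact0 phi x : lact 0 phi x = 0.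
Proof. by rewrite lact_pi. Qed.

Lemma lactD a b phi x : lact (a + b) phi x = lact a phi x + lact b phi x.
Proof. by elim/quotW: a => t; elim/quotW: b => u; rewrite -lpa_pi_add !lact_pi. Qed.

Lemma lactZ k a phi x : lact (k *: a) phi x = k * lact a phi x.
Proof. by elim/quotW: a => t; rewrite -lpa_pi_scale !lact_pi. Qed.

Lemma lactM a b phi : lact (a ** b) phi = lact a (lact b phi).
Proof. by elim/quotW: a => t; elim/quotW: b => u; rewrite -lpa_piM !lact_pi. Qed.

Lemma lmul0 a : 0 ** a = 0.
Proof. by apply: (@addrI _ (0 ** a)); rewrite -lpa_mulrDl !addr0. Qed.

Lemma lmulr0 a : a ** 0 = 0.
Proof. by apply: (@addrI _ (a ** 0)); rewrite -lpa_mulrDr !addr0. Qed.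

Lemma vertex_idem v : V v ** V v = V v.
Proof. by rewrite -lpa_piM; apply/lpa_piP/lpa_V_eq. Qed.

Lemma vertex_ortho v w : v <> w -> V v ** V w = 0.
Proof. by move=> vw; rewrite -lpa_piM; apply/lpa_piP/lpa_V_neq. Qed.

Lemma src_edge e : V (src e) ** Ed e = Ed e.
Proof. by rewrite -lpa_piM; apply/lpa_piP/lpa_P1_source. Qed.

Lemma edge_rng e : Ed e ** V (rng e) = Ed e.
Proof. by rewrite -lpa_piM; apply/lpa_piP/lpa_P1_range. Qed.

Lemma rng_ghost e : V (rng e) ** G e = G e.
Proof. by rewrite -lpa_piM; apply/lpa_piP/lpa_P2_range. Qed.

Lemma ghost_src e : G e ** V (src e) = G e.
Proof. by rewrite -lpa_piM; apply/lpa_piP/lpa_P2_source. Qed.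

Lemma vertex_CK2 v es : enumerates es v -> V v = \sum_(e <- es) Ed e ** G e.
Proof.
move=> [u ev e0].
have -> : V v = \pi_L (term_sum [seq TMul (TEdge e) (TGhost e) | e <- es]).
  exact/lpa_piP/lpa_CK2.
elim: es {u ev e0} => [|e es IH]; first by rewrite big_nil.
by rewrite big_cons -IH /= lpa_pi_add lpa_piM.
Qed.

(* The triple (p, q, v) stands for p q^*, where p and q have range v. *)
Definition monomial : Type := (seq (edge E) * seq (edge E) * vertex E)%type.
HB.instance Definition _ := gen_eqMixin monomial.
HB.instance Definition _ := gen_choiceMixin monomial.
Implicit Types (m : monomial) (l : seq (edge E)).

Definition real_path l v : L := foldr (fun e a => Ed e ** a) (V v) l.
Definition ghost_path l v : L := foldr (fun e a => a ** G e) (V v) l.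
Definition mono m : L := real_path m.1.1 m.2 ** ghost_path m.1.2 m.2.

Definition path_start l v := if l is e :: _ then src e else v.

Fixpoint is_path l v : Prop :=
  if l is e :: l' then rng e = path_start l' v /\ is_path l' v else True.

Lemma is_path_rcons l e : is_path l (src e) -> is_path (rcons l e) (rng e).
Proof.
have st : path_start (rcons l e) (rng e) = path_start l (src e) by case: l.
elim: l st => [//|f l IH] _ /= [-> ?]; split; last by apply: IH => //; case: (l).
by case: (l).
Qed.

Lemma real_path_vertex l v : real_path l v ** V v = real_path l v.
Proof.
elim: l => [|e l IH] /=; first exact: vertex_idem.
by rewrite -lpa_mulrA IH.
Qed.

Lemma vertex_ghost_path l v : V v ** ghost_path l v = ghost_path l v.
Proof.
elim: l => [|e l IH] /=; first exact: vertex_idem.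
by rewrite lpa_mulrA IH.
Qed.

Lemma real_path_rcons l e :
  real_path (rcons l e) (rng e) = real_path l (src e) ** Ed e.
Proof.
elim: l => [|f l IH] /=; first by rewrite src_edge edge_rng.
by rewrite IH lpa_mulrA.
Qed.

Lemma ghost_path_rcons l e :
  ghost_path (rcons l e) (rng e) = G e ** ghost_path l (src e).
Proof.
elim: l => [|f l IH] /=; first by rewrite ghost_src rng_ghost.
by rewrite IH lpa_mulrA.
Qed.

(** Insert [v] between [p] and [q^*] and expand it by CK2; both paths grow by one edge. *)
Lemma mono_CK2 p q v es : enumerates es v ->
  mono (p, q, v) = \sum_(e <- es) mono (rcons p e, rcons q e, rng e).
Proof.
move=> ev; rewrite /mono /= -real_path_vertex -lpa_mulrA.
have src_es e : List.In e es -> src e = v by case: ev => _ + _ => /(_ e)[].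
rewrite (vertex_CK2 ev); elim: es {ev} src_es => [|e es IH] src_es.
  by rewrite !big_nil lmul0 lmulr0.
rewrite !big_cons lpa_mulrDl lpa_mulrDr IH; last first.
  by move=> f fes; apply: src_es; right.
congr (_ + _); have <- : src e = v by apply: src_es; left.
by rewrite real_path_rcons ghost_path_rcons !lpa_mulrA.
Qed.

(** * Spanning by reduced monomials *)

Definition spanned (P : monomial -> Prop) a := exists s : seq (K * monomial),
  (forall t, t \in s -> P t.2) /\ a = \sum_(t <- s) t.1 *: mono t.2.

Section Spanned.
Variable P : monomial -> Prop.

Lemma spanned0 : spanned P 0.
Proof. by exists [::]; rewrite big_nil. Qed.

Lemma spannedD a b : spanned P a -> spanned P b -> spanned P (a + b).
Proof.
move=> [s [Ps ->]] [s' [Ps' ->]]; exists (s ++ s'); rewrite big_cat; split=> // t.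
by rewrite mem_cat => /orP[/Ps|/Ps'].
Qed.

Lemma spannedZ k a : spanned P a -> spanned P (k *: a).
Proof.
move=> [s [Ps ->]]; exists [seq (k * t.1, t.2) | t <- s]; split.
  by move=> _ /mapP[t /Ps Pt ->].
by rewrite big_map scaler_sumr; apply: eq_bigr => t _; rewrite scalerA.
Qed.

Lemma spanned_mono m : P m -> spanned P (mono m).
Proof.
move=> Pm; exists [:: (1, m)]; rewrite big_seq1 scale1r; split=> // t.
by rewrite inE => /eqP->.
Qed.

End Spanned.

Definition mono_path m := is_path m.1.1 m.2 /\ is_path m.1.2 m.2.

Lemma spanned_all a : spanned mono_path a.
Proof.
have [s ->] := lpa_span a; elim: s => [|t s IH].
  by rewrite big_nil; apply: spanned0.
rewrite big_cons; apply: spannedD IH; apply: spannedZ.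
have edges v w (p : path_between v w) : exists l, [/\ path_start l w = v,
    is_path l w, lpa_path_between K p = real_path l w &
    lpa_path_between_ghost K p = ghost_path l w].
  elim: p => [u|e u p [l [st pl pE gE]]]; first by exists [::].
  by exists (e :: l); rewrite /= pE gE.
case: t.1.2 t.2 => [v w p] [v' w' q]; rewrite /lpa_path /lpa_path_ghost /=.
have [l [_ lp -> _]] := edges _ _ p; have [l' [_ lq _ ->]] := edges _ _ q.
case: (pselect (w = w')) => [ww|/vertex_ortho ww].
  by subst w'; apply: (@spanned_mono _ (l, l', w)).
(* Paths with different ranges give the product 0, as distinct vertices are orthogonal. *)
rewrite -real_path_vertex -(vertex_ghost_path l') lpa_mulrA.
by rewrite -(lpa_mulrA _ (V w)) ww lmulr0 lmul0; apply: spanned0.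
Qed.

Definition reduced N m :=
  mono_path m /\ (size m.1.2 = N \/ (size m.1.2 < N)%N /\ ~ regular m.2).

(** Induction on [N - size q]: while [q] is too short and its range is regular, CK2 lengthens it by
    one edge. *)
Lemma spanned_reduced N m : mono_path m -> (size m.1.2 <= N)%N ->
  spanned (reduced N) (mono m).
Proof.
move def_d: (N - size m.1.2)%N => d.
elim: d m def_d => [|d IH] [[p q] v] /= dE mp le.
  by apply: spanned_mono; split=> //; left=> /=; lia.
case: (pselect (regular v)) => [[es ev]|nreg]; last first.
  by apply: spanned_mono; split=> //; right; split=> //=; lia.
have src_es e : List.In e es -> src e = v by case: ev => _ + _ => /(_ e)[].
rewrite (mono_CK2 _ _ ev); elim: es {ev} src_es => [|e es IHes] src_es.
  by rewrite big_nil; apply: spanned0.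
rewrite big_cons; apply: spannedD; last first.
  by apply: IHes => f fes; apply: src_es; right.
have ev : src e = v by apply: src_es; left.
subst v; case: mp => /= pp pq.
apply: IH => /=; rewrite ?size_rcons; [lia| |lia].
by split; apply: is_path_rcons.
Qed.

Lemma exists_reduced a : exists N, spanned (reduced N) a.
Proof.
have [s [Ps ->]] := spanned_all a.
have [N leN] : exists N, forall t, t \in s -> (size t.2.1.2 <= N)%N.
  elim: s {Ps} => [|t s [N leN]]; first by exists 0%N.
  exists (maxn (size t.2.1.2) N) => u; rewrite inE => /orP[/eqP->|/leN].
    exact: leq_maxl.
  by move=> le; apply: leq_trans le _; apply: leq_maxr.
exists N; elim: s Ps leN => [|t s IH] Ps leN.
  by rewrite big_nil; apply: spanned0.
rewrite big_cons; apply: spannedD; last first.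
  by apply: IH => u us; [apply: Ps|apply: leN]; rewrite inE us orbT.
apply/spannedZ/spanned_reduced; first by apply: Ps; rewrite mem_head.
by apply: leN; rewrite mem_head.
Qed.

(** * Monomials acting on boundary paths *)

Definition prepend l x := foldr (@pcons E) x l.

Lemma prepend_inj l l' x y : size l = size l' ->
  prepend l x = prepend l' y -> l = l' /\ x = y.
Proof.
elim: l l' => [|e l IH] [|f l'] //= [/IH{}IH] xy.
have [<-] : inr e = inr f :> node E := congr1 (fun z => z.1 0%N) xy.
by have := congr1 (@ptail E) xy; rewrite !pconsK => /IH[-> ->].
Qed.

Lemma prepend_level l x : (prepend l x).2 = x.2 + (size l)%:Z.
Proof. by elim: l => [|e l /= ->] /=; lia. Qed.

(** Once [l'] is stripped, [y] starts with the nonempty remainder of [l]. This excludes points that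
    stop at once. *)
Lemma prepend_shorter l l' x y : (size l' < size l)%N ->
  prepend l x = prepend l' y -> exists e, y.1 0%N = inr e.
Proof.
elim: l l' => [|e l IH] [|f l'] //= => [_ <-|/IH{}IH xy]; first by exists e.
by have := congr1 (@ptail E) xy; rewrite !pconsK => /IH.
Qed.

Lemma prepend_valid l v x : is_path l v -> at_vertex v x ->
  valid (prepend l x) /\ start (prepend l x) = path_start l v.
Proof.
move=> + xv; elim: l => [|e l IH] //= [ev /IH[vl sl]].
by split=> //; apply/valid_pcons; rewrite ev.
Qed.

(** No [is_path] hypothesis is made: if [l] is not a path ending at [v], validity of [y] makes the
    domain empty. *)
Lemma lact_real_path l v phi : lact (real_path l v) phi =
  pull (fun y => valid y /\ exists2 x, at_vertex v x & y = prepend l x)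
       (iter (size l) (@ptail E)) phi.
Proof.
elim: l phi => [|e l IH] phi /=.
  rewrite lact_pi /=; apply: eq_pull => // x.
  by split=> [xv|[_ [_ xv ->]] //]; split; [case: xv|exists x].
rewrite lactM IH lact_pi /= pull_comp; apply: eq_pull => y; last first.
  by move=> _ /=; rewrite -iterS iterSr.
split=> [[[vy ye] [_ [x xv yx]]]|[vy [x xv yx]]].
  by split=> //; exists x; rewrite // -yx ptailK.
have ye : y.1 0%N = inr e by rewrite yx.
by split=> //; split; [apply: valid_ptail|exists x; rewrite // yx pconsK].
Qed.

Lemma lact_ghost_path l v phi : lact (ghost_path l v) phi =
  pull (fun x => at_vertex v x /\ valid (prepend l x)) (prepend l) phi.
Proof.
elim: l phi => [|e l IH] phi /=.
  by rewrite lact_pi /=; apply: eq_pull => // x; rewrite /at_vertex /=; tauto.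
rewrite lactM IH lact_pi /= pull_comp; apply: eq_pull => // x.
rewrite valid_pcons /at_vertex; tauto.
Qed.

Definition delta z x : K := (x == z)%:R.

Lemma delta_fin_supp z : fin_supp (delta z).
Proof. by exists [:: z] => x; rewrite inE /delta => /negbTE ->. Qed.

Lemma lact_mono_diag p q v x : is_path p v -> is_path q v -> at_vertex v x ->
  lact (mono (p, q, v)) (delta (prepend q x)) (prepend p x) = 1.
Proof.
move=> pp pq xv; rewrite lactM lact_real_path lact_ghost_path pull_comp /pull /=.
have -> : iter (size p) (@ptail E) (prepend p x) = x.
  by elim: (p) => [//|e l IH]; rewrite [size _]/= iterSr /= pconsK.
have [vp _] := prepend_valid pp xv; have [vq _] := prepend_valid pq xv.
by rewrite asboolT /delta ?eqxx //; split=> //; split=> //; exists x.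
Qed.

Lemma lact_mono_neq0 p q v z y :
  lact (mono (p, q, v)) (delta z) y != 0 ->
  exists x, [/\ at_vertex v x, y = prepend p x & z = prepend q x].
Proof.
rewrite lactM lact_real_path lact_ghost_path pull_comp /pull /=.
case: asboolP => [[[vy [x xv ->]] [_ _]]|]; rewrite ?eqxx //.
have -> : iter (size p) (@ptail E) (prepend p x) = x.
  by elim: (p) => [//|e l IH]; rewrite [size _]/= iterSr /= pconsK.
rewrite /delta; have [<- _|_] := eqVneq _ z; last by rewrite eqxx.
by exists x.
Qed.

(** Choose an outgoing edge at every regular vertex and a stop at every other one, then iterate from
    [v]. *)
Lemma exists_point (v : vertex E) :
  exists2 x, at_vertex v x & ~ regular v -> x.1 0%N = inl v.
Proof.
have /choice[next nextP] (w : vertex E) : exists n : node E,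
    match n with inl u => u = w /\ ~ regular w | inr e => src e = w /\ regular w end.
  case: (pselect (regular w)) => [[[|e es] ees]|nreg]; first by case: ees.
    exists (inr e); split; last by exists (e :: es).
    by have [_ ew _] := ees; apply/ew; left.
  by exists (inl w).
(* After a stop at [u] the iteration repeats [inl u], which is valid since [u] is not regular. *)
pose target (n : node E) := match n with inl u => u | inr e => rng e end.
pose f i := iter i (next \o target) (next v).
have srcn w : node_src (next w) = w by have := nextP w; case: (next w) => ? [].
exists (f, 0) => [|nreg] /=.
  split; last exact: srcn.
  have spec w : match next w with inl u => ~ regular u
      | inr e => node_src (next (rng e)) = rng e end.
    by have := nextP w; case: (next w) => [u [->]|e _].
  move=> i; rewrite /f /=; case: i => [|i] /=.
    by have := spec v; case: (next v).
  by move: (target _) => w; have := spec w; case: (next w).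
have := nextP v; by case: (next v) => [u [->]|e [_ /nreg]].
Qed.

(** * Coefficients of reduced sums and faithfulness *)

Definition coef (s : seq (K * monomial)) m : K := \sum_(t <- s | t.2 == m) t.1.

(** A list may repeat a monomial, so terms are first grouped by monomial. Both [W = K^o], for values
    of the action, and [W = L] are needed. *)
Lemma coef_eq0 (W : lmodType K) (s : seq (K * monomial)) (Q : pred monomial)
    (F : monomial -> W) : (forall m, Q m -> coef s m = 0) ->
  \sum_(t <- s | Q t.2) t.1 *: F t.2 = 0.
Proof.
move=> c0; pose u := undup [seq t.2 | t <- s].
transitivity (\sum_(t <- s | Q t.2) \sum_(m <- u | m == t.2) t.1 *: F m).
  rewrite big_seq_cond [RHS]big_seq_cond; apply: eq_bigr => t /andP[ts _].
  have tu : t.2 \in u by rewrite mem_undup map_f.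
  by rewrite -big_filter (filter_pred1_uniq (undup_uniq _) tu) big_seq1.
rewrite (exchange_big_dep Q) /=; last by move=> t m Qt /eqP->.
apply: big1 => m Qm; rewrite -scaler_suml.
rewrite (eq_bigl (fun t => t.2 == m)); last first.
  by move=> t; rewrite [m == _]eq_sym andbC; case: eqP => [->|].
by rewrite -/(coef s m) c0 // scale0r.
Qed.

Lemma lact_sum (s : seq (K * monomial)) phi x :
  lact (\sum_(t <- s) t.1 *: mono t.2) phi x
  = \sum_(t <- s) t.1 * lact (mono t.2) phi x.
Proof.
elim: s => [|t s IH]; first by rewrite !big_nil lact0.
by rewrite !big_cons lactD lactZ IH.
Qed.

Lemma coef_reduced N (s : seq (K * monomial)) :
  (forall t, t \in s -> reduced N t.2) ->
  (forall z y, lact (\sum_(t <- s) t.1 *: mono t.2) (delta z) y = 0) ->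
  forall m, coef s m = 0.
Proof.
move=> red act0 m; have [n] := ubnP (size m.1.2).
elim: n m => // n IH m; rewrite ltnS => le_n.
have [/mapP[t ts mt]|notin] := boolP (m \in [seq t.2 | t <- s]);
  last first.
  rewrite /coef big_seq_cond big1 // => t /andP[ts /eqP tm].
  by case/mapP: notin; exists t.
move: le_n (red _ ts); rewrite {m}mt; move: (t.2) => [[p q] v] {t ts}.
rewrite /reduced /mono_path /= => le_n [[pp pq] pN].
have [x xv x_sing] := exists_point v.
have := act0 (prepend q x) (prepend p x).
(* Terms whose second path is shorter than [q] cancel by the induction hypothesis. *)
rewrite lact_sum (bigID (fun t => (size t.2.1.2 < size q)%N)) /=.
rewrite (@coef_eq0 K^o s (fun m => (size m.1.2 < size q)%N)
  (fun m => lact (mono m) (delta (prepend q x)) (prepend p x))); last first.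
  by move=> m lt; apply: IH; apply: leq_trans lt le_n.
(* It remains to see that [(p, q, v)] contributes its coefficient times 1 and every other monomial
   contributes 0. *)
rewrite add0r => <-; rewrite /coef big_mkcond [RHS]big_mkcond.
apply: eq_big_seq => t ts /=.
have [->|ne] := eqVneq t.2 (p, q, v).
  by rewrite ltnn lact_mono_diag ?mulr1.
case: ltnP => //= le_q; move/red: ts ne.
move: (t.2) le_q => [[p' q'] w] /= le_q [_ /= q'N] ne.
apply/esym/eqP; rewrite mulf_eq0; apply/orP; right; apply/negPn/negP.
move/lact_mono_neq0 => [y [yw px qx]].
move: le_q; rewrite leq_eqVlt => /orP[/eqP eq_q|lt_q]; last first.
  (* A longer [q'] gives [size q < N], so [v] is not regular and [x] stops at once, yet [x] must
     begin with an edge of [q']. *)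
  have [e xe] := prepend_shorter lt_q (esym qx).
  suff : ~ regular v by move/x_sing; rewrite xe.
  by case: pN => [|[]//]; case: q'N => [|[]]; lia.
have [qq' xy] := prepend_inj eq_q qx.
(* Since [x = y], comparing levels in [px] forces equal lengths. *)
have eq_p : size p = size p'.
  by have := congr1 snd px; rewrite !prepend_level xy; lia.
have [pp' _] := prepend_inj eq_p px.
by case/eqP: ne; rewrite -pp' -qq' -(proj2 xv) -(proj2 yw) xy.
Qed.

Lemma lact_faithful a : (forall z y, lact a (delta z) y = 0) -> a = 0.
Proof.
have [N [s [red ->]]] := exists_reduced a => act0.
have c0 := coef_reduced red act0.
exact: (@coef_eq0 L s predT mono (fun m _ => c0 m)).
Qed.

End Faithful.

(** * Properness from faithfulness and definiteness *)

Theorem proposition2p3 (K : fieldType) (bar : involution (@GRing.mul K))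
    (E : digraph) (hbar : positive_definite_involution bar) :
  proper_involution (lpa_star bar E).
Proof.
move=> x; rewrite big_ord1 => xx0 i; rewrite ord1 {i}.
apply: lact_faithful => z; have fz := delta_fin_supp K z.
apply: (inner_definite hbar); first exact: act_fin_supp.
(* Moving [x] across the inner product produces [x^* x], which is 0. *)
rewrite inner_act //; last exact: act_fin_supp.
rewrite /inner fsbig1 // => y _.
by rewrite -lact_pi lpa_pi_star reprK -lactM xx0 lact0 mulr0.
Qed.
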